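(* Let $p\in(0,1)$ and let $R$ be a non-negative integer-valued random variable. Let $(M_n)_{n\in\mathbb{Z}_+}$ be i.i.d. with the same distribution as $R$, let $(X_n)_{n\in\mathbb{Z}_+}$ be i.i.d. Bernoulli($p$) random variables independent of $(M_n)_{n\in\mathbb{Z}_+}$, and let $\mathbb{P}$ denote their joint law. Let $\mathcal{G}$ be the random oriented graph with ranges $(M_n)_{n\in\mathbb{Z}_+}$ and let $W_0$ be the set of words seen from the vertex $0$. Then: 1. If $\displaystyle\limsup_{n\to\infty} nP(R\geq n)<\frac{1}{\min\{p,1-p\}}$, then $\mathbb{P}(W_0=\Xi)=0$. 2. If $\displaystyle\liminf_{n\to\infty} nP(R\geq n)>\frac{3}{\min\{p,1-p\}}$, then $\mathbb{P}(W_0=\Xi)>0$.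
   Context: $\mathbb{Z}_+=\{0,1,2,\dots\}$, $\mathbb{N}=\{1,2,3,\dots\}$. A word is a sequence $\xi=(\xi_1,\xi_2,\dots)\in\Xi:=\{0,1\}^{\mathbb{N}}$. Given ranges $(M_n)_{n\in\mathbb{Z}_+}$, the graph $\mathcal{G}=(\mathbb{Z}_+,\mathcal{E})$ is the oriented graph with edge set $\mathcal{E}=\bigcup_{n\in\mathbb{Z}_+}\{(n,n+i): i\in\mathbb{N},\ 0<i\leq M_n\}$. The letter $X_n\in\{0,1\}$ is assigned to vertex $n$, with $X_n=1$ with probability $p$. A word $\xi$ is seen from a vertex $v_0$ if there is a sequence of distinct vertices $v_1,v_2,\dots$ such that $(v_{i-1},v_i)\in\mathcal{E}$ and $X_{v_i}=\xi_i$ for every $i\geq1$ (the letter at $v_0$ plays no role). For a vertex $v$, $W_v=\{\xi\in\Xi:\xi\text{ is seen from }v\}$. *)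

(* Defs.v *)
From HB Require Import structures.
From mathcomp Require Import all_boot all_order all_algebra.
From mathcomp Require Import finmap.
From mathcomp Require Import all_classical all_reals all_analysis.
Set Implicit Arguments.
Unset Strict Implicit.
Unset Printing Implicit Defensive.
Import Order.TTheory GRing.Theory Num.Theory.
Import numFieldNormedType.Exports.
Local Open Scope classical_set_scope.
Local Open Scope ring_scope.

Definition mutually_independent d (T : measurableType d) (R : realType)
    (P : probability T R) d' (U : measurableType d')
    (Y : nat -> {RV P >-> U}) : Prop :=
  forall (J : {fset nat}) (B : nat -> set U),
    (forall j, j \in J -> measurable (B j)) ->
    P (\bigcap_(j in [set` J]) (Y j @^-1` B j))
      = (\prod_(j <- J) P (Y j @^-1` B j))%E.

Definition iid_with_law d (T : measurableType d) (R : realType)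
    (P : probability T R) d' (U : measurableType d')
    (mu : probability U R) (Y : nat -> {RV P >-> U}) : Prop :=
  mutually_independent Y /\
  (forall (n : nat) (B : set U), measurable B -> distribution P (Y n) B = mu B).

Definition sequence_sigma_algebra d (T : measurableType d) (R : realType)
    (P : probability T R) d' (U : measurableType d')
    (Y : nat -> {RV P >-> U}) : set (set T) :=
  <<s \bigcup_n preimage_set_system setT (Y n) measurable >>.

Definition independent_sequences d (T : measurableType d) (R : realType)
    (P : probability T R) d1 (U1 : measurableType d1) d2 (U2 : measurableType d2)
    (Y : nat -> {RV P >-> U1}) (Z : nat -> {RV P >-> U2}) : Prop :=
  forall A B : set T,
    sequence_sigma_algebra Y A -> sequence_sigma_algebra Z B ->
    P (A `&` B) = (P A * P B)%E.

(* Letters are booleans ([true] is the letter 1), and words are indexed from 0: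
   [xi i] is the letter usually written xi_(i+1). *)
Definition word := nat -> bool.

Definition edges (M : nat -> nat) : set (nat * nat) :=
  \bigcup_n [set (n, (n + i)%N) | i in [set i | (0 < i <= M n)%N]].

(* Only v_1, v_2, ... are required to be distinct, and the letter at v_0 plays
   no role. *)
Definition seen_from (M : nat -> nat) (X : nat -> bool) (v0 : nat) (xi : word)
    : Prop :=
  exists v : nat -> nat,
    [/\ v 0%N = v0,
        injective (fun i => v i.+1),
        forall i, edges M (v i, v i.+1)
      & forall i, X (v i.+1) = xi i].

Definition words_seen (M : nat -> nat) (X : nat -> bool) (v : nat) : set word :=
  [set xi | seen_from M X v xi].

(* Main.v *)
Require Import Defs.
From mathcomp Require Import all_boot all_order all_algebra.
From mathcomp Require Import finmap.
From mathcomp Require Import all_classical all_reals all_analysis.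
From mathcomp Require Import zify ring lra.
Set Implicit Arguments.
Unset Strict Implicit.
Unset Printing Implicit Defensive.
Import Order.TTheory GRing.Theory Num.Theory.
Import numFieldNormedType.Exports.
Local Open Scope classical_set_scope.
Local Open Scope ring_scope.

(** Ranges and letters are attached independently to the vertices, so every event
    below is computed from products over vertices.

    The event that all words are seen from 0 is measurable by compactness:
    out-degrees are finite, hence an infinite word is seen as soon as all its
    finite prefixes can be read along finite paths ([words_seen_setTP]).

    Light tails.  Let [a] be the rarer letter, of probability [q], and consider the
    constant word [a].  Call [n] a barrier if neither 0 nor a vertex before [n]
    with letter [a] reaches [n]; no path that reads the constant word can cross a
    barrier ([barrier_not_seen]).  Given a barrier at [k], a later [n] is a barrier
    with probability [u (n - k)], independently of the past, where
    [u n] is the product of the [1 - q P(R >= j)] over [1 <= j <= n]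
    ([pr_barrier_renewal]).  Counting the barriers in [1, K] by means of the first
    one bounds the probability that there is none by [1 / (q * U K)], where [U K]
    is the sum of the first [K] values of [u] ([pr_barrier_free_le]).  If
    [n P(R >= n)] is eventually at most [1 / q], then [u n] is at least of order
    [1 / n] and [U K] diverges ([sum_survival_unbounded]), so almost surely the
    constant word is not seen.

    Heavy tails.  Let block [j] be the set of vertices from [j ^ 3] to [2 j ^ 3].  If
    every vertex of block [j + 1] is reached, for each of the two letters, by a
    vertex of block [j] with that letter, and if 0 reaches the end of the first
    block used, then all words are seen at once ([ladder_reads]).  A vertex is
    missed by a window of vertices at distances between [s] and [t] with probability
    at most of order [(s / t) ^ 3] ([gap_product_le]), so block [j] fails with
    probability of order [j ^ -3] ([pr_startI_failure_le]).  Starting far enough,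
    these probabilities add up to at most one half, and the remaining requirement
    that 0 has a large range is independent and has positive probability
    ([pr_all_words_seen_gt0]). *)

(** * Words, finite paths and compactness *)

Definition arrow (M : nat -> nat) : rel nat := fun u v => (u < v <= u + M u)%N.

Definition reads (M : nat -> nat) (X : nat -> bool) (u : nat) (s : seq bool) :=
  exists t, path (arrow M) u t /\ map X t = s.

Lemma edgesE M u v : edges M (u, v) <-> arrow M u v.
Proof.
rewrite /edges /arrow; split=> [[n _ [i /= Hi [<- <-]]]|H]; first by lia.
by exists u => //; exists (v - u)%N => /=; [lia|congr pair; lia].
Qed.

Section words.
Variables (M : nat -> nat) (X : nat -> bool).

Lemma seen_from_reads u xi n : seen_from M X u xi -> reads M X u (mkseq xi n).
Proof.
case=> v [<- _ vE vX]; exists [seq v i.+1 | i <- iota 0 n]; split; last first.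
  by rewrite -map_comp; apply: eq_map => i /=.
suff H i : path (arrow M) (v i) [seq v j.+1 | j <- iota i n] by apply: (H 0%N).
elim: n i => //= n IHn i; rewrite IHn andbT; exact/edgesE.
Qed.

(** Only finitely many vertices lie one arrow away from [u].  If each of them
    failed on some prefix of the shifted word, a prefix of the word longer than
    all these failures could not be read from [u]. *)
Lemma konig_step u s :
  (forall n, reads M X u (mkseq s n.+1)) ->
  exists u', [/\ arrow M u u', X u' = s 0%N
               & forall n, reads M X u' (mkseq (fun i => s i.+1) n)].
Proof.
move=> H; apply: contrapT => N.
have bad u' : arrow M u u' -> X u' = s 0%N ->
    exists n, ~ reads M X u' (mkseq (fun i => s i.+1) n).
  move=> auu' Xu'; apply: contrapT => Hn; apply: N; exists u'; split=> // n.
  by apply: contrapT => Hr; apply: Hn; exists n.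
have /choice[f fP] u' : exists n, arrow M u u' -> X u' = s 0%N ->
    ~ reads M X u' (mkseq (fun i => s i.+1) n).
  have [[auu' Xu']|H'] := pselect (arrow M u u' /\ X u' = s 0%N).
    by have [n Hn] := bad _ auu' Xu'; exists n.
  by exists 0%N => auu' Xu'; case: H'.
pose m := (\max_(i < (u + M u).+1) f i)%N.
have [[|u' t] [//= /andP[auu' pt] [Xu' tE]]] := H m.
apply: (fP u' auu' Xu'); exists (take (f u') t); split; first exact: take_path.
have lu' : (u' < (u + M u).+1)%N by case/andP: auu' => _; rewrite ltnS.
have lfm : (f u' <= m)%N := leq_bigmax (Ordinal lu').
rewrite map_take tE -map_take take_iota (minn_idPl lfm).
by rewrite /mkseq (map_comp s S) -(iotaDl 1 0).
Qed.

(** König's lemma: the vertices are chosen one after the other so that every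
    remaining prefix can still be read. *)
Lemma reads_seen_from u xi : (forall n, reads M X u (mkseq xi n)) ->
  seen_from M X u xi.
Proof.
move=> H; pose good i v := forall n, reads M X v (mkseq (fun j => xi (i + j)%N) n).
have /choice[next nextP] (iv : nat * nat) : exists v', good iv.1 iv.2 ->
    [/\ arrow M iv.2 v', X v' = xi iv.1 & good iv.1.+1 v'].
  case: iv => i v /=; have [Hiv|] := pselect (good i v); last by exists 0%N.
  have [v' [av Xv' gv']] := @konig_step v (fun j => xi (i + j)%N)
    (fun n => Hiv n.+1).
  exists v' => _; split=> //; first by rewrite Xv' addn0.
  by move=> n; rewrite /good; under eq_mkseq do rewrite addSnnS; exact: gv'.
pose v := fix v i := if i is j.+1 then next (j, v j) else u.
have vgood i : good i (v i).
  elim: i => [|i IHi]; first by move=> n; exact: H.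
  by have [] := nextP (i, v i) IHi.
have vP i : arrow M (v i) (v i.+1) /\ X (v i.+1) = xi i.
  by have [] := nextP (i, v i) (vgood i).
exists v; split=> //.
- have vlt i j : (i < j)%N -> (v i < v j)%N.
    by elim: j => // j IHj; have [/andP[H1 _] _] := vP j;
      rewrite ltnS leq_eqVlt => /predU1P[-> //|/IHj H2]; exact: ltn_trans H1.
  move=> i j /eqP; case: (ltngtP i j) => // lij.
    by rewrite ltn_eqF// vlt.
  by rewrite gtn_eqF// vlt.
- by move=> i; apply/edgesE; case: (vP i).
- by move=> i; case: (vP i).
Qed.

(** Compactness replaces the uncountable family of infinite words by countably
    many finite ones, so that the event studied below is measurable. *)
Lemma words_seen_setTP u :
  words_seen M X u = setT <-> forall s, reads M X u s.
Proof.
split=> [H s|H]; last first.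
  by apply/seteqP; split=> // xi _; apply: reads_seen_from.
have : words_seen M X u (nth true s) by rewrite H.
by move/(seen_from_reads (size s)); rewrite mkseq_nth.
Qed.

(** Apart from its starting point, a path that reads the constant word [a] only
    visits vertices with letter [a].  If neither these nor 0 reach [n], the
    path stays below [n], which is absurd since it increases strictly. *)
Lemma barrier_not_seen a n : (0 < n)%N ->
  (forall v, (v < n)%N -> (v == 0%N) || (X v == a) -> (v + M v < n)%N) ->
  ~ seen_from M X 0 (fun=> a).
Proof.
move=> n0 Hn [v [v0 _ vE vX]].
have vP i : (i <= v i)%N /\ (v i < n)%N.
  elim: i => [|i [IH1 IH2]]; first by rewrite v0.
  have /edgesE/andP[H1 H2] := vE i; split; first exact: leq_ltn_trans H1.
  apply: leq_ltn_trans H2 _; apply: Hn => //.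
  by case: i {IH1 IH2 H1} => [|i]; rewrite ?v0 ?vX ?eqxx ?orbT.
by have [H1 H2] := vP n; move: (leq_ltn_trans H1 H2); rewrite ltnn.
Qed.

(** Think of [a j, b j] as the rungs of a ladder.  Each vertex of a rung has,
    for each letter, a predecessor with that letter in the rung below; a path
    reading a given word is built backwards from its last vertex, and the range
    of vertex 0 covers the lowest rung.  One ladder serves all words. *)
Lemma ladder_reads (a b : nat -> nat) k : (0 < a k)%N -> (b k <= M 0)%N ->
  (forall j, a j <= b j)%N ->
  (forall j x y, (k <= j)%N -> (a j.+1 <= y <= b j.+1)%N ->
     exists v, [/\ (a j <= v <= b j)%N, arrow M v y & X v = x]) ->
  forall s, reads M X 0 s.
Proof.
move=> ak bk ab step.
have H s y : (a (k + size s)%N <= y <= b (k + size s)%N)%N ->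
    exists t, path (arrow M) 0 (rcons t y) /\ map X t = s.
  elim/last_ind: s y => [|s x IHs] y.
    rewrite addn0 => /andP[H1 H2]; exists [::]; split=> //=.
    by rewrite /arrow /= andbT (leq_trans ak H1) add0n (leq_trans H2).
  rewrite size_rcons addnS => /step -/(_ x (leq_addr _ _))[v [Hv av Xv]].
  have [t [pt tE]] := IHs v Hv; exists (rcons t v); split.
    by rewrite rcons_path pt last_rcons.
  by rewrite map_rcons tE Xv.
move=> s; have [|t [pt tE]] := H s (a (k + size s)%N); first by rewrite leqnn ab.
by exists t; split=> //; move: pt; rewrite rcons_path => /andP[].
Qed.

End words.

(** * Survival products and sums *)

Section renewal_sequences.
Variable R : realType.
Implicit Types (r u f : nat -> R) (q : R).

(** If [q] is the frequency of a letter and [r j] the probability of a range of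
    at least [j], this is the probability that none of the [n] vertices before a
    given one both carries the letter and reaches it. *)
Definition survival (q : R) r n : R := \prod_(1 <= j < n.+1) (1 - q * r j).

Lemma survival0 q r : survival q r 0 = 1.
Proof. by rewrite /survival big_geq. Qed.

Lemma survivalS q r n : survival q r n.+1 = survival q r n * (1 - q * r n.+1).
Proof. by rewrite /survival big_nat_recr. Qed.

Lemma survival_gt0 q r n : (forall j, q * r j < 1) -> 0 < survival q r n.
Proof. by move=> H; apply: prodr_gt0 => j _; rewrite subr_gt0. Qed.

(** The summands are the differences of consecutive survival products. *)
Lemma sum_survival_tail q r K :
  \sum_(0 <= n < K) q * r n.+1 * survival q r n = 1 - survival q r K.
Proof.
elim: K => [|K IHK]; first by rewrite big_geq// survival0 subrr.
by rewrite big_nat_recr//= IHK survivalS; ring.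
Qed.

(** The factor of rank [n + 1] is at least [n / (n + 1)], so that [n] times the
    survival product is eventually nondecreasing. *)
Lemma survival_ge q r N n : (forall j, q * r j < 1) ->
  (forall j, (N <= j)%N -> j%:R * (q * r j) <= 1) -> (N <= n)%N ->
  survival q r N * N%:R <= survival q r n * n%:R.
Proof.
move=> H HN /subnK <-; elim: (n - N)%N => [|i IHi]; first by rewrite add0n.
apply: le_trans IHi _; rewrite addSn survivalS.
have := HN (i + N).+1 (leqW (leq_addl _ _)); have := survival_gt0 (i + N)%N H.
rewrite -natr1; set a := survival _ _ _; nra.
Qed.

Lemma harmonic_sum_unbounded (A : R) :
  exists K, A < \sum_(0 <= n < K) n.+1%:R^-1.
Proof.
apply: contrapT => H; apply: (@dvg_harmonic R).
apply: nondecreasing_is_cvgn.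
  by apply: nondecreasing_series => n _ _; rewrite /= invr_ge0.
exists A => _ [K _ <-]; rewrite leNgt; apply/negP => lA; apply: H; exists K.
by move: lA; rewrite /series.
Qed.

(** By the previous bound the survival products are eventually above a multiple
    of the harmonic series. *)
Lemma sum_survival_unbounded q r N (A : R) : (forall j, q * r j < 1) ->
  (forall j, (N <= j)%N -> j%:R * (q * r j) <= 1) ->
  exists K, A < \sum_(0 <= n < K) survival q r n.
Proof.
move=> H HN; have HN' j : (N.+1 <= j)%N -> j%:R * (q * r j) <= 1.
  by move=> /ltnW; exact: HN.
pose c := survival q r N.+1 * N.+1%:R.
have c0 : 0 < c by rewrite mulr_gt0 ?survival_gt0.
have [K AK] := harmonic_sum_unbounded (A / c + \sum_(0 <= n < N.+1) n.+1%:R^-1).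
exists K; have s0 n := survival_gt0 n H.
have [KN|NK] := leqP K N.+1.
  have := @ler_wpM2l _ c (ltW c0) _ _ (ltW AK).
  have le : \sum_(0 <= n < K) n.+1%:R^-1 <= \sum_(0 <= n < N.+1) n.+1%:R^-1 :> R.
    rewrite (big_cat_nat (leq0n K) KN) /= lerDl; apply: sumr_ge0 => n _.
    by rewrite invr_ge0.
  have A0 : A < 0.
    have : A / c < 0 by rewrite -(ltrD2r (\sum_(0 <= n < N.+1) n.+1%:R^-1)) add0r;
       exact: lt_le_trans AK le.
    by rewrite pmulr_llt0 ?invr_gt0.
  by move=> _; apply: lt_le_trans A0 _; apply: sumr_ge0 => n _; exact: ltW.
rewrite (big_cat_nat (leq0n N.+1) (ltnW NK)) /=.
move: AK; rewrite [X in _ < X](big_cat_nat (leq0n N.+1) (ltnW NK)) /= addrC ltrD2r.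
rewrite ltr_pdivrMr// => AK; apply: lt_le_trans AK _.
rewrite -[leLHS]add0r lerD//.
  by apply: sumr_ge0 => n _; exact: ltW.
rewrite mulr_suml; apply: ler_sum_nat => n /andP[Nn _].
have := survival_ge H HN' Nn; rewrite -/c => cn.
rewrite mulrC ler_pdivrMr//; apply: le_trans cn _.
by rewrite ler_pM2l// ler_nat.
Qed.

(** The left-hand side is the part below the diagonal [k + i < K] of the
    expanded product on the right. *)
Lemma sum_convolution_le f u K : (forall n, 0 <= f n) -> (forall n, 0 <= u n) ->
  \sum_(0 <= n < K) \sum_(0 <= k < n.+1) f k * u (n - k)%N
  <= (\sum_(0 <= k < K) f k) * (\sum_(0 <= n < K) u n).
Proof.
move=> f0 u0.
have -> : \sum_(0 <= n < K) \sum_(0 <= k < n.+1) f k * u (n - k)%N =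
    \sum_(0 <= n < K) \sum_(0 <= k < K | (k < n.+1)%N) f k * u (n - k)%N.
  by apply: eq_big_nat => n /andP[_ nK]; rewrite (big_nat_widen _ _ _ _ _ nK).
rewrite (exchange_big_dep_nat xpredT)//= mulr_suml.
apply: ler_sum_nat => k /= kK.
rewrite -mulr_sumr; apply: ler_wpM2l => //.
have -> : \sum_(0 <= i < K | (k < i.+1)%N) u (i - k)%N
        = \sum_(0 <= i < K - k) u i.
  rewrite (big_cat_nat (leq0n k) (ltnW kK)) /= big_nat_cond big1 ?add0r; last first.
    by move=> i /andP[/andP[_ ik]]; rewrite ltnS leqNgt ik.
  rewrite -{1}(add0n k) big_addn.
  by apply: eq_big => i; rewrite ?addnK// ltnS leq_addl.
rewrite (big_cat_nat (leq0n (K - k)) (leq_subr _ _))//= lerDl.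
by apply: sumr_ge0.
Qed.

Lemma one_sub_le_cube (t z : R) : 3 * t <= z -> 0 < t -> t <= 1 ->
  1 - z <= (1 - t) ^+ 3.
Proof.
move=> zt t0 t1.
have t2 : 0 <= t ^+ 2 * (3 - t) by apply: mulr_ge0; [exact: sqr_ge0|lra].
have -> : (1 - t) ^+ 3 = 1 - 3 * t + t ^+ 2 * (3 - t) by ring.
by rewrite -[leLHS]addr0 lerD// lerD2l lerN2.
Qed.

(** With [j = y - v], each factor is at most [1 - 3 / j <= ((j - 1) / j) ^ 3],
    and these bounds telescope.  Keeping [hi] at distance [N] from [y] ensures
    that only those [j] occur for which the hypothesis on [r] is available. *)
Lemma gap_product_le (x : R) r N lo hi y : (0 < N)%N ->
  (forall j, x * r j <= 1) -> (forall j, (N <= j)%N -> 3 <= j%:R * (x * r j)) ->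
  (lo <= hi)%N -> (hi + N <= y)%N ->
  \prod_(lo <= v < hi) (1 - x * r (y - v)%N)
    <= ((y - hi)%:R / (y - lo)%:R) ^+ 3.
Proof.
move=> N0 x1 x3 lohi; elim: hi lohi => [|hi IHhi].
  by rewrite leqn0 => /eqP -> Ny; rewrite big_geq// divff ?expr1n//;
     rewrite pnatr_eq0 subn0; lia.
rewrite leq_eqVlt => /predU1P[-> Ny|].
  by rewrite big_geq// divff ?expr1n// pnatr_eq0; lia.
rewrite ltnS => lohi Ny; rewrite big_nat_recr//=.
have {IHhi} := IHhi lohi (leq_trans (leqnSn _) Ny); set p := \prod_(_ <= _ < _) _.
have := x1 (y - hi)%N; have := x3 (y - hi)%N.
have -> : (y - hi = (y - hi.+1).+1)%N by lia.
set s := (y - hi.+1)%N => x3s x1s ps.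
have {}x3s : 3 <= s.+1%:R * (x * r s.+1) by apply: x3s; lia.
have s0 : (0 : R) < s.+1%:R by [].
have f1 : 1 - x * r s.+1 <= (s%:R / s.+1%:R) ^+ 3.
  have {}x3s : 3 / s.+1%:R <= x * r s.+1 by rewrite ler_pdivrMr// mulrC.
  have -> : s%:R / s.+1%:R = 1 - s.+1%:R^-1 :> R.
    by rewrite -natr1; field; rewrite natr1 pnatr_eq0.
  have : 0 < s.+1%:R^-1 :> R by rewrite invr_gt0.
  have : s.+1%:R^-1 <= 1 :> R by rewrite invf_le1// ler1n.
  by move=> t1 t0; exact: one_sub_le_cube.
have -> : s%:R / (y - lo)%:R = s.+1%:R / (y - lo)%:R * (s%:R / s.+1%:R) :> R.
  have yl0 : (y - lo)%:R != 0 :> R by rewrite pnatr_eq0; lia.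
  have {s0} := lt0r_neq0 s0; move: yl0.
  by move: (s.+1%:R : R) ((y - lo)%:R : R) => a b b0 a0; field; rewrite a0 b0.
rewrite exprMn; apply: ler_pM => //; last by rewrite subr_ge0.
by apply: prodr_ge0 => v _; rewrite subr_ge0.
Qed.

(** Telescoping, since [1 / m ^ 3 <= 1 / (m - 1) - 1 / m]. *)
Lemma sum_inv_cube_le k0 n : (1 < k0)%N ->
  \sum_(0 <= i < n) ((k0 + i)%:R ^+ 3)^-1 <= (k0.-1%:R)^-1 :> R.
Proof.
move=> k1; suff : \sum_(0 <= i < n) ((k0 + i)%:R ^+ 3)^-1
   <= (k0.-1%:R)^-1 - ((k0 + n).-1%:R)^-1 :> R.
  by move=> /le_trans; apply; rewrite gerBl invr_ge0.
elim: n => [|n IHn]; first by rewrite big_geq// addn0 subrr.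
rewrite big_nat_recr//=; apply: le_trans (lerD IHn (lexx _)) _.
rewrite -addrA lerD2l addnS /=.
case E: (k0 + n)%N => [|m] /=; first by lia.
have m0 : (0 < m)%N by lia.
have : (1 : R) <= m%:R by rewrite ler1n.
rewrite -natr1; move: (m%:R) => z z1.
rewrite -subr_ge0.
have -> : - (z + 1)^-1 - (- z^-1 + ((z + 1) ^+ 3)^-1)
  = (z ^+ 2 + z + 1) / (z * (z + 1) ^+ 3).
  by field; apply/andP; split; lra.
by apply: divr_ge0; nra.
Qed.

End renewal_sequences.

(** * Real-valued probabilities *)

Section real_probability.
Context d (T : measurableType d) (R : realType) (P : probability T R).

(** Probabilities taken in the reals, where subtraction and products obey the
    ring laws without finiteness conditions. *)
Definition pr (E : set T) : R := fine (P E).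

Lemma prE E : measurable E -> P E = (pr E)%:E.
Proof. by move=> mE; rewrite fineK// fin_num_measure. Qed.

Lemma pr_ge0 E : 0 <= pr E.
Proof. exact: fine_ge0. Qed.

Lemma pr_setT : pr setT = 1.
Proof. by rewrite /pr probability_setT. Qed.

Lemma pr_set0 : pr set0 = 0.
Proof. by rewrite /pr measure0. Qed.

Lemma le_pr E F : measurable E -> measurable F -> E `<=` F -> pr E <= pr F.
Proof.
by move=> mE mF EF; rewrite -lee_fin -!prE//; apply: le_measure; rewrite ?inE.
Qed.

Lemma pr_le1 E : measurable E -> pr E <= 1.
Proof. by move=> mE; rewrite -pr_setT; apply: le_pr. Qed.

Lemma pr_setID E F : measurable E -> measurable F ->
  pr E = pr (E `&` F) + pr (E `\` F).
Proof.
move=> mE mF; apply: EFin_inj; rewrite EFinD -!prE//.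
- by rewrite addeC -measureDI.
- exact: measurableD.
- exact: measurableI.
Qed.

Lemma pr_setU_le E F : measurable E -> measurable F ->
  pr (E `|` F) <= pr E + pr F.
Proof.
move=> mE mF; rewrite -lee_fin EFinD -!prE//; last exact: measurableU.
exact: measureU2.
Qed.

Lemma measurable_exists_seq (I : eqType) (s : seq I) (E : I -> set T) :
  (forall i, measurable (E i)) -> measurable [set w | exists2 i, i \in s & E i w].
Proof.
move=> mE; elim: s => [|i s IHs].
  by rewrite (_ : mkset _ = set0)//; apply/seteqP; split=> // w [].
rewrite (_ : mkset _ = E i `|` [set w | exists2 i, i \in s & E i w]).
  exact: measurableU.
apply/seteqP; split=> w /= => [[j]|[Ei|[j js Ej]]].
- by rewrite inE => /predU1P[-> ?|? ?]; [left|right; exists j].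
- by exists i; rewrite ?mem_head.
- by exists j; rewrite // inE js orbT.
Qed.

Lemma pr_exists_seq_le (I : eqType) (s : seq I) (E : I -> set T) :
  (forall i, measurable (E i)) ->
  pr [set w | exists2 i, i \in s & E i w] <= \sum_(i <- s) pr (E i).
Proof.
move=> mE; elim: s => [|i s IHs].
  by rewrite big_nil (_ : mkset _ = set0) ?pr_set0//; apply/seteqP; split=> // w [].
rewrite big_cons; apply: le_trans (lerD (lexx _) IHs).
apply: le_trans (pr_setU_le (mE i) (measurable_exists_seq s mE)).
apply: le_pr; first exact: measurable_exists_seq.
  by apply: measurableU => //; exact: measurable_exists_seq.
by move=> w [j]; rewrite inE => /predU1P[-> ?|? ?]; [left|right; exists j].
Qed.

End real_probability.

(** * Cylinder events of independent ranges and letters *)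

Section cylinders.
Context d (T : measurableType d) (R : realType) (P : probability T R).
Variables (M : nat -> {RV P >-> nat}) (X : nat -> {RV P >-> bool}).

Implicit Type C : nat -> nat -> bool -> bool.

Definition cyl lo hi C : set T :=
  [set w | forall v, (lo <= v < hi)%N -> C v (M v w) (X v w)].

Lemma measurable_coord v (c : nat -> bool -> bool) :
  measurable [set w | c (M v w) (X v w)].
Proof.
have H b : measurable (M v @^-1` [set m | c m b] `&` X v @^-1` [set b]).
  by apply: measurableI; rewrite -[_ @^-1` _]setTI; exact: measurable_funP.
rewrite (_ : mkset _ = M v @^-1` [set m | c m true] `&` X v @^-1` [set true] `|`
   M v @^-1` [set m | c m false] `&` X v @^-1` [set false]).
  exact: measurableU.
apply/seteqP; split=> w /=; first by case: (X v w); [left|right].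
by case=> -[? ->].
Qed.

Lemma measurable_cyl lo hi C : measurable (cyl lo hi C).
Proof.
rewrite (_ : cyl _ _ _ = \bigcap_(v in [set v | (lo <= v < hi)%N])
    [set w | C v (M v w) (X v w)]) //.
by apply: bigcap_measurableType => v _; exact: measurable_coord.
Qed.

Variables (muM : probability nat R) (muX : probability bool R).
Hypotheses (iidM : iid_with_law muM M) (iidX : iid_with_law muX X).
Hypothesis indepMX : independent_sequences M X.

Lemma sequence_sigma_algebra_prefix d' (U : measurableType d')
    (Y : nat -> {RV P >-> U}) n (B : nat -> set U) :
  (forall v, measurable (B v)) ->
  sequence_sigma_algebra Y [set w | forall v, (v < n)%N -> B v (Y v w)].
Proof.
move=> mB; rewrite /sequence_sigma_algebra.
set G := (\bigcup_n _).
apply: (@bigcap_measurableType _ (g_sigma_algebraType G)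
  (fun v => Y v @^-1` B v) [set v | (v < n)%N]).
move => v _; apply: sub_sigma_algebra; exists v => //.
by exists (B v) => //; rewrite setTI.
Qed.

Lemma mutually_independent_prefix d' (U : measurableType d')
    (mu : probability U R) (Y : nat -> {RV P >-> U}) n (B : nat -> set U) :
  iid_with_law mu Y -> (forall v, measurable (B v)) ->
  P [set w | forall v, (v < n)%N -> B v (Y v w)] =
    (\prod_(0 <= v < n) pr mu (B v))%:E.
Proof.
move=> [ind law] mB; pose J := seq_fset tt (iota 0 n).
have JE v : (v \in J) = (v < n)%N by rewrite seq_fsetE mem_iota.
rewrite (_ : mkset _ = \bigcap_(j in [set` J]) (Y j @^-1` B j)); last first.
  by apply/seteqP; split=> w H v; [rewrite /= JE => /H | rewrite -JE => /H].
rewrite ind//.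
have pJ : perm_eq J (iota 0 n).
  by apply: uniq_perm; rewrite ?fset_uniq ?iota_uniq// => v; rewrite JE mem_iota.
rewrite (perm_big _ pJ) /= /index_iota subn0.
elim: (iota 0 n) => [|v s IHs]; first by rewrite !big_nil.
by rewrite !big_cons IHs EFinM -prE// -(law v).
Qed.

(** A constraint on one vertex that bears separately on its range and on its
    letter: only for such constraints does the independence of the two sequences
    apply directly. *)
Definition rectangular (c : nat -> bool -> bool) :=
  exists B D, forall m x, c m x = B m && D x.

(** The probability that one vertex satisfies the constraint [c], under the
    product of the law of the ranges and the law of the letters. *)
Definition marg (c : nat -> bool -> bool) : R :=
  \sum_(b : bool) pr muX [set b] * pr muM [set m | c m b].

Lemma marg_bool c : marg c =
  pr muX [set true] * pr muM [set m | c m true]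
  + pr muX [set false] * pr muM [set m | c m false].
Proof. by rewrite /marg big_bool. Qed.

Lemma marg_rectangular B D :
  marg (fun m x => B m && D x) = pr muM [set m | B m] * pr muX [set x | D x].
Proof.
rewrite marg_bool (@pr_setID _ _ _ muX [set x | D x] [set true])//.
have -> : [set x | D x] `\` [set true] = [set x | D x] `&` [set false].
  by apply/seteqP; split=> -[] /= [].
have DE b : [set x | D x] `&` [set b] = if D b then [set b] else set0.
  case: ifPn => Db; apply/seteqP; split=> x /=.
  - by case.
  - by move=> ->.
  - by case=> Dx xb; move: Db; rewrite -xb Dx.
  - by [].
have BE b : [set m | B m && D b] = if D b then [set m | B m] else set0.
  by case: (D b); apply/seteqP; split=> m /=; rewrite ?andbT ?andbF.
by rewrite !DE !BE; case: (D true); case: (D false); rewrite ?pr_set0; ring.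
Qed.

Lemma pr_cyl_rectangular n C : (forall v, rectangular (C v)) ->
  pr P (cyl 0 n C) = \prod_(0 <= v < n) marg (C v).
Proof.
move=> /choice[B /choice[D CE]].
have -> : cyl 0 n C = [set w | forall v, (v < n)%N -> [set m | B v m] (M v w)]
    `&` [set w | forall v, (v < n)%N -> [set x | D v x] (X v w)].
  apply/seteqP; split=> w /= => [H|[H H'] v /= vn].
    by split=> v /H; rewrite CE => /andP[].
  by rewrite CE H ?H'.
rewrite /pr indepMX; [|
  exact: (@sequence_sigma_algebra_prefix _ _ M n (fun v => [set m | B v m]))|
  exact: (@sequence_sigma_algebra_prefix _ _ X n (fun v => [set x | D v x]))].
rewrite (mutually_independent_prefix n (B := fun v => [set m | B v m]) iidM)//.
rewrite (mutually_independent_prefix n (B := fun v => [set x | D v x]) iidX)//.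
rewrite -EFinM /= -big_split /=; apply: eq_bigr => v _.
rewrite -marg_rectangular; congr marg; apply/funext => m; apply/funext => x.
by rewrite CE.
Qed.

(** A constraint that couples range and letter is the disjoint union, over the
    two letters, of rectangular ones.  The induction is on the number [k] of
    leading vertices with arbitrary constraints; splitting the event according
    to the letter of vertex [k] makes that constraint rectangular. *)
Lemma pr_cyl0 n C : pr P (cyl 0 n C) = \prod_(0 <= v < n) marg (C v).
Proof.
suff gen k : forall C, (forall v, (k <= v)%N -> rectangular (C v)) ->
    pr P (cyl 0 n C) = \prod_(0 <= v < n) marg (C v).
  have -> : cyl 0 n C =
      cyl 0 n (fun v => if (v < n)%N then C v else fun _ _ => true).
    by apply/seteqP; split=> w H v vn; have := H v vn; move: vn => /= ->.
  rewrite (gen n).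
    by rewrite !big_nat; apply: eq_bigr => v /= ->.
  by move=> v nv; rewrite ltnNge nv /=; exists xpredT, xpredT.
elim: k => {C}[|k IHk] C rC; first by apply: pr_cyl_rectangular => v; exact: rC.
have [nk|kn] := leqP n k.
  pose C' v := if (v < n)%N then C v else fun _ _ => true.
  have -> : cyl 0 n C = cyl 0 n C'.
    by apply/seteqP; split=> w H v vn; have := H v vn; rewrite /C';
      move: vn => /= ->.
  rewrite IHk.
    by rewrite !big_nat; apply: eq_bigr => v /= vn; rewrite /C' vn.
  by move=> v kv; rewrite /C' ltnNge (leq_trans nk kv); exists xpredT, xpredT.
pose Cb b v := if v == k then fun m x => C k m b && (x == b) else C v.
have pb b : pr P (cyl 0 n (Cb b)) = \prod_(0 <= v < n) marg (Cb b v).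
  apply: IHk => v; rewrite /Cb; case: eqVneq => [_ _|vk kv].
    by exists (C k ^~ b), (pred1 b).
  by apply: rC; rewrite ltn_neqAle eq_sym vk.
have mk : measurable [set w | X k w] by exact: (@measurable_coord k (fun _ x => x)).
rewrite (pr_setID P (measurable_cyl 0 n C) mk).
have -> : cyl 0 n C `&` [set w | X k w] = cyl 0 n (Cb true).
  apply/seteqP; split=> w /= => [[H Xk] v vn|H].
    rewrite /Cb; case: eqVneq => [->|_]; last exact: H.
      by have := H k kn; rewrite Xk => ->.
  have := H k kn; rewrite /Cb eqxx => /andP[Ck /eqP Xk]; split=> // v vn.
  by have := H v vn; rewrite /Cb; case: eqVneq => // -> _; rewrite Xk.
have -> : cyl 0 n C `\` [set w | X k w] = cyl 0 n (Cb false).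
  apply/seteqP; split=> w /= => [[H /negP/negbTE Xk] v vn|H].
    rewrite /Cb; case: eqVneq => [->|_]; last exact: H.
      by have := H k kn; rewrite Xk => ->.
  have := H k kn; rewrite /Cb eqxx => /andP[Ck /eqP Xk]; split; last by rewrite Xk.
  move=> v vn.
  by have := H v vn; rewrite /Cb; case: eqVneq => // -> _; rewrite Xk.
rewrite !pb.
have kI : k \in index_iota 0 n by rewrite mem_index_iota.
rewrite !(bigD1_seq k kI (iota_uniq _ _)) /=.
have E b : \prod_(0 <= v < n | v != k) marg (Cb b v)
         = \prod_(0 <= v < n | v != k) marg (C v).
  by apply: eq_bigr => v vk; rewrite /Cb (negbTE vk).
rewrite !E -mulrDl; congr (_ * _).
rewrite /Cb eqxx !marg_rectangular marg_bool.
rewrite (_ : [set x | x == true] = [set true]); last by apply/seteqP; split=> x /eqP.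
rewrite (_ : [set x | x == false] = [set false]); last first.
  by apply/seteqP; split=> x /eqP.
ring.
Qed.

Lemma marg_true : marg (fun _ _ => true) = 1.
Proof.
have E U : [set x : U | xpredT x] = setT by apply/seteqP; split.
by rewrite (marg_rectangular xpredT xpredT) !E !pr_setT mulr1.
Qed.

Lemma pr_cyl lo hi C : pr P (cyl lo hi C) = \prod_(lo <= v < hi) marg (C v).
Proof.
have -> : cyl lo hi C =
    cyl 0 hi (fun v => if (lo <= v)%N then C v else fun _ _ => true).
  apply/seteqP; split=> w H v /=.
    by move=> vh; case: ifP => // lv; apply: H; rewrite lv.
  by move=> /andP[lv vh]; have := H v vh; rewrite lv.
have [hl|lh] := leqP hi lo.
  rewrite pr_cyl0 [RHS]big_geq// big_nat big1// => v /= vh.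
  by rewrite leqNgt (leq_trans vh hl) marg_true.
rewrite pr_cyl0 (big_cat_nat _ (ltnW lh))//= [X in X * _]big_nat big1 ?mul1r.
  by rewrite !big_nat; apply: eq_bigr => v /andP[->].
by move=> v /= vl; rewrite leqNgt vl marg_true.
Qed.

Lemma cyl_cat lo k hi C C' : (lo <= k <= hi)%N ->
  cyl lo k C `&` cyl k hi C'
  = cyl lo hi (fun v => if (v < k)%N then C v else C' v).
Proof.
move=> /andP[lk kh]; apply/seteqP; split=> w => [[H H'] v /andP[lv vh]|H].
  by case: ltnP => vk; [apply: H|apply: H']; apply/andP.
split=> v /andP[lv vh].
  by have := H v; rewrite vh; apply; rewrite lv (leq_trans vh kh).
by have := H v; rewrite vh (leq_trans lk lv) ltnNge lv /=; apply.
Qed.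

Lemma pr_cylI lo k hi C C' : (lo <= k <= hi)%N ->
  pr P (cyl lo k C `&` cyl k hi C') = pr P (cyl lo k C) * pr P (cyl k hi C').
Proof.
move=> lkh; rewrite cyl_cat// !pr_cyl; case/andP: lkh => lk kh.
rewrite (big_cat_nat lk kh) /=; congr (_ * _); rewrite !big_nat.
  by apply: eq_bigr => v /andP[_ ->].
by apply: eq_bigr => v /andP[kv _]; rewrite ltnNge kv.
Qed.

Definition avoid (A : nat -> set T) (js : seq nat) : set T :=
  [set w | forall j, j \in js -> ~ A j w].

Lemma measurable_avoid A js : (forall j, measurable (A j)) ->
  measurable (avoid A js).
Proof.
move=> mA; rewrite (_ : avoid _ _ = \bigcap_(j in [set j | j \in js]) ~` A j)//.
by apply: bigcap_measurableType => j _; exact: measurableC.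
Qed.

(** Vertices below [k] are independent of the later ones, also for an event that
    asks to avoid cylinders: the avoided sets are removed one at a time by
    [P (E minus A) = P E - P (E and A)], where the intersection with [A] is
    absorbed into the constraint [C] on the vertices below [k]. *)
Lemma pr_avoidI k hi (A : nat -> nat -> nat -> bool -> bool) js C C' :
  (forall j, j \in js -> (j <= k)%N) -> (k <= hi)%N ->
  pr P ((cyl 0 k C `&` avoid (fun j => cyl 0 j (A j)) js) `&` cyl k hi C')
  = pr P (cyl 0 k C `&` avoid (fun j => cyl 0 j (A j)) js) * pr P (cyl k hi C').
Proof.
move=> + kh; elim: js C => [C _|j js IHjs C jk].
  rewrite (_ : avoid _ _ = setT); last by apply/seteqP; split.
  by rewrite setIT pr_cylI.
set V' := avoid _ _; pose V := avoid (fun j => cyl 0 j (A j)) js.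
have mV : measurable V by apply: measurable_avoid => i; exact: measurable_cyl.
have V'E : V' = V `\` cyl 0 j (A j).
  apply/seteqP; split=> w /= => [H|[H H'] i].
    by split=> [i ijs|]; apply: H; rewrite inE ?ijs ?orbT ?eqxx.
  by rewrite inE => /predU1P[->//|]; exact: H.
have lejk : (j <= k)%N by apply: jk; rewrite mem_head.
pose CA v m x := C v m x && (if (v < j)%N then A j v m x else true).
have CAE : cyl 0 k C `&` cyl 0 j (A j) = cyl 0 k CA.
  apply/seteqP; split=> w /= => [[H H'] v vk|H].
    by rewrite /CA H//=; case: ifP => // vj; exact: H'.
  split=> v vk; first by have /andP[] := H v vk.
  by have /andP[_] := H v (leq_trans (vk : (v < j)%N) lejk); rewrite ifT.
have IH D : pr P ((cyl 0 k D `&` V) `&` cyl k hi C')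
     = pr P (cyl 0 k D `&` V) * pr P (cyl k hi C').
  by apply: IHjs => i ijs; apply: jk; rewrite inE ijs orbT.
have mC := measurable_cyl.
have := pr_setID P (measurableI _ _ (mC 0%N k C) mV) (mC 0%N j (A j)).
have -> : cyl 0 k C `&` V `&` cyl 0 j (A j) = cyl 0 k CA `&` V.
  by rewrite -CAE setIAC.
rewrite setDE -setIA -setDE -V'E => E1.
have := pr_setID P (measurableI _ _ (measurableI _ _ (mC 0%N k C) mV) (mC k hi C'))
  (mC 0%N j (A j)).
have -> : cyl 0 k C `&` V `&` cyl k hi C' `&` cyl 0 j (A j)
    = cyl 0 k CA `&` V `&` cyl k hi C'.
  by rewrite -CAE setIAC; congr (_ `&` _); exact: setIAC.
have -> : (cyl 0 k C `&` V `&` cyl k hi C') `\` cyl 0 j (A j)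
   = cyl 0 k C `&` V' `&` cyl k hi C'.
  by rewrite V'E !setDE setIAC setIA.
rewrite !IH E1 mulrDl => /addrI.
by [].
Qed.

End cylinders.

(** * The event that all words are seen *)

Section model.
Context d (T : measurableType d) (R : realType) (P : probability T R).
Variables (M : nat -> {RV P >-> nat}) (X : nat -> {RV P >-> bool}).

Definition all_words_seen : set T :=
  [set w | words_seen (M ^~ w) (X ^~ w) 0%N = [set: word]].

Lemma measurable_reads u s :
  measurable [set w | reads (M ^~ w) (X ^~ w) u s].
Proof.
rewrite (_ : mkset _ = \bigcup_t
  [set w | path (arrow (M ^~ w)) u t /\ map (X ^~ w) t = s]); last first.
  by apply/seteqP; split=> w /= => [[t]|[t _]]; exists t.
apply: countable_bigcupT_measurable => // t.
elim: t u s => [|v t IHt] u [|x s].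
- by rewrite (_ : mkset _ = setT)//; apply/seteqP; split.
- by rewrite (_ : mkset _ = set0)//; apply/seteqP; split=> // w [].
- by rewrite (_ : mkset _ = set0)//; apply/seteqP; split=> // w [].
rewrite (_ : mkset _ = [set w | (u < v <= u + M u w)%N] `&` [set w | X v w == x]
   `&` [set w | path (arrow (M ^~ w)) v t /\ map (X ^~ w) t = s]).
  apply: measurableI; last exact: IHt.
  apply: measurableI.
    exact: (@measurable_coord _ _ _ _ M X u (fun m _ => (u < v <= u + m)%N)).
  exact: (@measurable_coord _ _ _ _ M X v (fun _ b => b == x)).
apply/seteqP; split=> w /=.
  by move=> [/andP[auv pt] [<- <-]]; rewrite eqxx.
by move=> [[auv /eqP <-] [pt <-]]; split=> //; apply/andP.
Qed.

Lemma measurable_all_words_seen : measurable all_words_seen.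
Proof.
rewrite (_ : all_words_seen =
    ~` \bigcup_s ~` [set w | reads (M ^~ w) (X ^~ w) 0%N s]).
  apply: measurableC; apply: countable_bigcupT_measurable => // s.
  exact/measurableC/measurable_reads.
rewrite setC_bigcup; apply/seteqP; split=> w /=.
  by move=> /words_seen_setTP H s _; rewrite setCK; exact: H.
by move=> H; apply/words_seen_setTP => s; have := H s I; rewrite setCK.
Qed.

Variables (muM : probability nat R) (muX : probability bool R).
Hypotheses (iidM : iid_with_law muM M) (iidX : iid_with_law muX X).
Hypothesis indepMX : independent_sequences M X.

Let letter x : R := pr muX [set x].
Let tail j : R := pr muM [set m | (j <= m)%N].
Let pcyl := pr_cyl iidM iidX indepMX.

Lemma letter_sum : letter true + letter false = 1.
Proof.
rewrite -(pr_setT muX) (@pr_setID _ _ _ muX setT [set true])// setTI setTD.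
congr (_ + pr _ _); apply/seteqP; split=> x /=; first by move=> ->.
by case: x.
Qed.

Lemma pr_short j : pr muM [set m | (m < j)%N] = 1 - tail j.
Proof.
rewrite -(pr_setT muM) (@pr_setID _ _ _ muM setT [set m | (j <= m)%N])//.
rewrite setTI setTD addrAC subrr add0r; congr (pr _ _).
by apply/seteqP; split=> m /=; rewrite ltnNge => /negP.
Qed.

Lemma marg_short a j :
  marg muM muX (fun m x => (x == a) ==> (m < j)%N) = 1 - letter a * tail j.
Proof.
have ET : [set m : nat | true] = setT by apply/seteqP; split.
rewrite marg_bool -/(letter true) -/(letter false).
by have := letter_sum; case: a; rewrite /= !pr_short ET pr_setT; nra.
Qed.

(** * Barriers form a renewal process *)

Section renewal.
Variable a : bool.

Definition barrier n : nat -> nat -> bool -> bool :=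
  fun v m x => (v == 0)%N || (x == a) ==> (v + m < n)%N.

Let A n := cyl M X 0 n (barrier n).
Let u := survival (letter a) tail.

(** Reversing the order, the vertex at distance [j] from [n] fails to reach [n]
    with probability [1 - letter a * tail j]. *)
Lemma pr_barrier k n : (0 < k <= n)%N ->
  pr P (cyl M X k n (barrier n)) = u (n - k)%N.
Proof.
move=> /andP[k0 kn]; rewrite pcyl /u /survival big_add1 /=.
rewrite -{1}(add0n k) big_addn big_nat_rev /= add0n.
apply: eq_big_nat => v /andP[_ vnk].
have nv : (n - (n - k - v.+1 + k))%N = v.+1 by lia.
rewrite -{2}nv -marg_short; congr marg; apply/funext => m; apply/funext => x.
rewrite /barrier addn_eq0 [X in _ && X]eqn0Ngt k0 andbF /=.
by congr (_ ==> _); lia.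
Qed.

(** Vertex 0 counts whatever its letter, hence the first factor. *)
Lemma pr_barrier0 n : pr P (A n.+1) = (1 - tail n.+1) * u n.
Proof.
have := @pr_barrier 1 n.+1 isT; rewrite subn1 /= => <-.
rewrite /A !pcyl [LHS]big_ltn//; congr (_ * _).
have ET : [set m : nat | true] = setT by apply/seteqP; split.
rewrite marg_bool -/(letter true) -/(letter false) !pr_short -mulrDl.
by rewrite letter_sum mul1r.
Qed.

Let N k := avoid A (iota 1 k).

Lemma barrier_freeS k : N k.+1 = N k `\` A k.+1.
Proof.
apply/seteqP; split=> w /=.
  move=> H; split; last by apply: H; rewrite mem_iota; lia.
  by move=> j; rewrite mem_iota => jk; apply: H; rewrite mem_iota; lia.
move=> [H H'] j; rewrite mem_iota => jk; have [->//|jk'] := eqVneq j k.+1.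
by apply: H; rewrite mem_iota; lia.
Qed.

Let mA n : measurable (A n). Proof. exact: measurable_cyl. Qed.
Let mN k : measurable (N k). Proof. exact: measurable_avoid. Qed.

(** The summands are the probabilities that [E] holds and that the first barrier
    is at [k + 1]; they add up to the probability of [E] with some barrier in
    [1, K]. *)
Lemma sum_pr_first_barrier E K : measurable E ->
  \sum_(0 <= k < K) pr P (E `&` N k `&` A k.+1) = pr P E - pr P (E `&` N K).
Proof.
move=> mE; elim: K => [|K IHK].
  rewrite big_geq// (_ : N 0 = setT) ?setIT ?subrr//.
  by apply/seteqP; split.
rewrite big_nat_recr//= IHK barrier_freeS setIDA.
rewrite (pr_setID P (measurableI _ _ mE (mN K)) (mA K.+1)).
ring.
Qed.

(** Once [k + 1] is a barrier, no earlier vertex can reach [n + 1] either, so only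
    the vertices from [k + 1] on, independent of the past, matter. *)
Lemma pr_barrier_renewal k n : (k <= n)%N ->
  pr P (A n.+1 `&` N k `&` A k.+1) = pr P (N k `&` A k.+1) * u (n - k)%N.
Proof.
move=> kn; rewrite -subSS -pr_barrier ?kn// [N k `&` _]setIC.
rewrite -(pr_avoidI iidM iidX indepMX)//; last first.
  by move=> j; rewrite mem_iota; lia.
congr (pr _ _); rewrite -setIA [X in _ `&` X]setIC setIC.
rewrite -!/(A _) -/(N k).
apply/seteqP; split=> w [AN H]; split=> //; first by move=> v /andP[_ vn]; exact: H.
move=> v vn; have [vk|kv] := ltnP v k.+1; last by apply: H; rewrite kv.
by case: AN => /(_ v vk) /implyP + _ => h; apply/implyP => /h; lia.
Qed.

(** The expected number of barriers in [1, K] is on the one hand the sum of the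
    [(1 - tail (n + 1)) * u n]; on the other hand, by decomposition at the first
    barrier, it is at most the probability that there is a barrier times the
    sum of the [u n].  The difference of the two sums telescopes, and is bounded
    although the sum of the [u n] may diverge. *)
Lemma pr_barrier_free_le K :
  letter a * pr P (N K) * (\sum_(0 <= n < K) u n) <= 1 - u K.
Proof.
have f0 k : 0 <= pr P (N k `&` A k.+1) by exact: pr_ge0.
have decomp n : (1 - tail n.+1) * u n =
    \sum_(0 <= k < n.+1) pr P (N k `&` A k.+1) * u (n - k)%N.
  rewrite -pr_barrier0; transitivity (pr P (A n.+1) - pr P (A n.+1 `&` N n.+1)).
    rewrite (_ : A n.+1 `&` N n.+1 = set0) ?pr_set0 ?subr0//.
    by apply/seteqP; split=> // w; rewrite barrier_freeS => -[? []].
  rewrite -sum_pr_first_barrier//; apply: eq_big_nat => k /andP[_ kn].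
  exact: pr_barrier_renewal.
have la0 : 0 <= letter a by exact: pr_ge0.
have l1 : letter a <= 1 by exact: pr_le1.
have u0 n : 0 <= u n.
  apply: prodr_ge0 => j _; rewrite subr_ge0.
  by rewrite mulr_ile1 ?pr_ge0// pr_le1.
have := sum_convolution_le K f0 u0; under eq_bigr do rewrite -decomp.
have -> : \sum_(0 <= k < K) pr P (N k `&` A k.+1) = 1 - pr P (N K).
  have := @sum_pr_first_barrier setT K measurableT; rewrite setTI pr_setT => <-.
  by apply: eq_bigr => k _; rewrite setTI.
have := sum_survival_tail (letter a) tail K; rewrite -/u => E.
have -> : \sum_(0 <= n < K) (1 - tail n.+1) * u n
   = \sum_(0 <= n < K) u n - \sum_(0 <= n < K) tail n.+1 * u n.
  by rewrite -sumrB; apply: eq_bigr => n _; rewrite mulrBl mul1r.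
have {}E : letter a * (\sum_(0 <= n < K) tail n.+1 * u n) = 1 - u K.
  by rewrite -E mulr_sumr; apply: eq_bigr => n _; rewrite mulrA.
move=> le; rewrite -E -mulrA ler_wpM2l//; lra.
Qed.

Lemma all_words_seen_sub_avoid K : all_words_seen `<=` N K.
Proof.
move=> w Ww n; rewrite mem_iota => /andP[n0 _] An.
have : words_seen (M ^~ w) (X ^~ w) 0 (fun=> a) by rewrite Ww.
apply: (@barrier_not_seen _ _ a n) => // v vn.
by move: (An v vn) => /implyP.
Qed.

(** If all words are seen, so is the constant word [a], and there is no barrier at
    all; the probability of this is at most the inverse of [letter a] times a
    divergent sum. *)
Lemma pr_all_words_seen_eq0 n0 : 0 < letter a ->
  (forall j, letter a * tail j < 1) ->
  (forall j, (n0 <= j)%N -> j%:R * (letter a * tail j) <= 1) ->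
  P all_words_seen = 0%E.
Proof.
move=> l0 l1 ln; have mW := measurable_all_words_seen.
rewrite prE//; congr EFin; apply/eqP; rewrite eq_le pr_ge0 andbT leNgt.
apply/negP => W0.
have [K] := sum_survival_unbounded (letter a * pr P all_words_seen)^-1 l1 ln.
rewrite -/u => UK.
have := pr_barrier_free_le K; rewrite leNgt => /negP; apply.
apply: (@lt_le_trans _ _ 1).
  by rewrite gtrBl; apply: survival_gt0.
rewrite -ler_pdivrMl ?mulr1; last first.
  by rewrite mulr_gt0// (lt_le_trans W0)// le_pr//; exact: all_words_seen_sub_avoid.
apply: le_trans (ltW UK); rewrite lef_pV2 ?posrE ?mulr_gt0//.
  by rewrite ler_wpM2l ?(ltW l0)// le_pr//; exact: all_words_seen_sub_avoid.
by rewrite (lt_le_trans W0)// le_pr//; exact: all_words_seen_sub_avoid.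
Qed.

End renewal.

(** * Cubic blocks form a ladder *)

Section blocks.

(* Cubic growth leaves a gap of order j ^ 2 below the vertices of block j + 1, so
   that each of them is uncovered with probability of order j ^ -6, while block
   j has only order j ^ 3 vertices.  Conversely block j has to reach only order
   j ^ 2 beyond its end, which fails with probability of order j ^ -3. *)
Let block_lo j := (j ^ 3)%N.
Let block_hi j := (2 * j ^ 3)%N.

Definition uncovered (x : bool) lo hi y : set T :=
  cyl M X lo hi (fun v m b => (b == x) ==> (v + m < y)%N).

Lemma pr_uncovered x lo hi y : (hi <= y)%N ->
  pr P (uncovered x lo hi y)
  = \prod_(lo <= v < hi) (1 - letter x * tail (y - v)%N).
Proof.
move=> hy; rewrite pcyl; apply: eq_big_nat => v /andP[_ vh].
rewrite -marg_short; congr marg; apply/funext => m; apply/funext => b.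
by congr (_ ==> _); lia.
Qed.

Variable N : nat.
Hypothesis N_gt0 : (0 < N)%N.
Hypothesis heavy : forall x j, (N <= j)%N -> 3 <= j%:R * (letter x * tail j).

Let letter_tail_le1 x j : letter x * tail j <= 1.
Proof. by rewrite mulr_ile1 ?pr_ge0// pr_le1. Qed.

Lemma pr_uncovered_le x lo hi y : (lo <= hi)%N -> (hi + N <= y)%N ->
  pr P (uncovered x lo hi y) <= ((y - hi)%:R / (y - lo)%:R) ^+ 3.
Proof.
move=> lohi hy; rewrite pr_uncovered; last exact: leq_trans (leq_addr _ _) hy.
by apply: gap_product_le hy => // j Nj; exact: heavy.
Qed.

(** Cross-multiplied, so that the side condition is an inequality between natural
    numbers. *)
Lemma pr_uncovered_le_ratio x lo hi y s t : (lo <= hi)%N -> (hi + N <= y)%N ->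
  (0 < t)%N -> ((y - hi) * t <= s * (y - lo))%N ->
  pr P (uncovered x lo hi y) <= (s%:R / t%:R) ^+ 3.
Proof.
move=> lohi hy t0 st; apply: le_trans (pr_uncovered_le x lohi hy) _.
have yl : (0 < y - lo)%N by lia.
apply: lerXn2r; rewrite ?nnegrE ?divr_ge0//.
by rewrite ler_pdivrMr ?ltr0n// mulrAC ler_pdivlMr ?ltr0n// -!natrM ler_nat.
Qed.

(** Triples (letter, end of window, target).  Targets inside block [j] must be
    covered from vertices of the block that are [N] short of the target.  For the
    part of block [j + 1] beyond block [j] a single demand per letter is enough:
    a vertex that reaches the end of block [j + 1] also reaches everything in
    between. *)
Definition demands j : seq (bool * nat * nat) :=
  [seq (x, (y - N)%N, y) | x <- [:: true; false],
     y <- index_iota (block_lo j.+1) (block_hi j).+1]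
  ++ [seq (x, (block_hi j).+1, block_hi j.+1) | x <- [:: true; false]].

Definition failure j : set T :=
  [set w | exists2 i, i \in demands j & uncovered i.1.1 (block_lo j) i.1.2 i.2 w].

Lemma measurable_failure j : measurable (failure j).
Proof. by apply: measurable_exists_seq => i; exact: measurable_cyl. Qed.

Let start k : set T := cyl M X 0 1 (fun _ m _ => (block_hi k <= m)%N).

Lemma pr_start k : pr P (start k) = tail (block_hi k).
Proof.
by rewrite pcyl big_nat1 marg_bool -mulrDl -/(letter true) -/(letter false)
  letter_sum mul1r.
Qed.

Lemma pr_startI_uncovered k x lo hi y : (0 < lo)%N ->
  pr P (start k `&` uncovered x lo hi y)
  = tail (block_hi k) * pr P (uncovered x lo hi y).
Proof.
move=> lo0; have [lohi|hilo] := leqP lo hi; last first.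
  rewrite (_ : uncovered _ _ _ _ = setT) ?setIT ?pr_setT ?pr_start ?mulr1//.
  by apply/seteqP; split=> // w _ v; lia.
pose C v m b := (lo <= v)%N ==> ((b == x) ==> (v + m < y)%N).
have -> : uncovered x lo hi y = cyl M X 1 hi C.
  apply/seteqP; split=> w H v.
    by move=> /andP[_ vh]; apply/implyP => lv; apply: H; rewrite lv.
  move=> /andP[lv vh]; have := H v; rewrite vh (leq_trans lo0 lv) /C lv.
  exact.
by rewrite (pr_cylI iidM iidX indepMX) ?pr_start// (leq_trans lo0).
Qed.

(* The two terms account for the two kinds of demands, each for two letters:
   (N / j ^ 2) ^ 3 for each of the at most j ^ 3 inner targets, and
   (13 / j) ^ 3 for the end, where 13 j ^ 2 bounds the number
   6 j ^ 2 + 6 j + 1 of vertices to be jumped over. *)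
Let C0 : R := 2 * N%:R ^+ 3 + 2 * 13 ^+ 3.

Lemma pr_startI_failure_le k j : (N <= j)%N ->
  pr P (start k `&` failure j) <= tail (block_hi k) * (C0 * (j%:R ^+ 3)^-1).
Proof.
move=> Nj; have j0 : (0 < j)%N by exact: leq_trans Nj.
have jR0 : (0 : R) < j%:R by rewrite ltr0n.
have lo0 : (0 < block_lo j)%N by rewrite expn_gt0 j0.
rewrite (_ : _ `&` _ = [set w | exists2 i, i \in demands j &
    (start k `&` uncovered i.1.1 (block_lo j) i.1.2 i.2) w]); last first.
  apply/seteqP; split=> w /= => [[S [i iD U]]|[i iD [S U]]]; first by exists i.
  by split=> //; exists i.
apply: le_trans (pr_exists_seq_le P _ _) _.
  by move=> i; apply: measurableI; exact: measurable_cyl.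
under eq_bigr do rewrite pr_startI_uncovered//.
rewrite -mulr_sumr; apply: ler_wpM2l; first exact: pr_ge0.
rewrite big_cat big_allpairs_dep /C0 mulrDl; apply: lerD.
  have inner x : \sum_(y <- index_iota (block_lo j.+1) (block_hi j).+1)
      pr P (uncovered x (block_lo j) (y - N) y) <= N%:R ^+ 3 / j%:R ^+ 3.
    apply: (@le_trans _ _ (\sum_(y <- index_iota (block_lo j.+1) (block_hi j).+1)
        (N%:R / (j ^ 2)%:R) ^+ 3)).
      rewrite big_nat [leRHS]big_nat; apply: ler_sum => y /andP[ly yh].
      by apply: pr_uncovered_le_ratio; rewrite /block_lo /block_hi in ly yh *; nia.
    rewrite big_const_seq count_predT size_iota iter_addr_0 -[leLHS]mulr_natr.
    have cnt : ((block_hi j).+1 - block_lo j.+1 <= j ^ 3)%N.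
      by rewrite /block_lo /block_hi; nia.
    apply: (@le_trans _ _ ((N%:R / (j ^ 2)%:R) ^+ 3 * (j ^ 3)%:R)).
      by apply: ler_wpM2l; rewrite ?ler_nat// exprn_ge0// divr_ge0.
    by rewrite !natrX le_eqVlt; apply/orP; left; apply/eqP; field; lra.
  by rewrite !big_cons big_nil /= addr0 -mulrA mulr_natl mulr2n lerD.
rewrite !big_cons big_nil /= addr0 -mulrA mulr_natl mulr2n -expr_div_n.
by apply: lerD; apply: pr_uncovered_le_ratio; rewrite /block_lo /block_hi //; nia.
Qed.

(* Starting the ladder at k0 bounds the total probability of failure,
   conditionally on the range of vertex 0, by C0 / (k0 - 1) <= 1 / 2. *)
Let k0 := (N + Num.truncn (2 * C0)).+2.

Let good n : set T := start k0 `&` avoid (fun i => failure (k0 + i)) (iota 0 n).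

Lemma measurable_good n : measurable (good n).
Proof.
apply: measurableI; first exact: measurable_cyl.
by apply: measurable_avoid => i; exact: measurable_failure.
Qed.

(** The start only involves vertex 0 and is independent of the failures, so it
    factors out of the union bound. *)
Lemma pr_good_ge n : tail (block_hi k0)
    * (1 - C0 * \sum_(0 <= i < n) ((k0 + i)%:R ^+ 3)^-1) <= pr P (good n).
Proof.
elim: n => [|n IHn].
  rewrite big_geq// mulr0 subr0 mulr1 -pr_start /good.
  by rewrite (_ : avoid _ _ = setT) ?setIT//; apply/seteqP; split.
have gS : good n.+1 = good n `\` failure (k0 + n).
  rewrite /good -[n.+1]addn1 iotaD; apply/seteqP; split=> w /=.
    move=> [S H]; split; last by apply: H; rewrite mem_cat mem_head orbT.
    by split=> // j jn; apply: H; rewrite mem_cat jn.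
  move=> [[S H] F]; split=> // j; rewrite mem_cat inE => /orP[/H//|/eqP ->//].
have := pr_setID P (measurable_good n) (measurable_failure (k0 + n)).
rewrite -gS => E; rewrite big_nat_recr//=.
have le1 : pr P (good n `&` failure (k0 + n)) <=
    pr P (start k0 `&` failure (k0 + n)).
  apply: le_pr; [apply: measurableI|apply: measurableI|].
  - exact: measurable_good.
  - exact: measurable_failure.
  - exact: measurable_cyl.
  - exact: measurable_failure.
  - by move=> w [[S _] F].
have Nk : (N <= k0 + n)%N by rewrite /k0; lia.
have := pr_startI_failure_le k0 Nk.
move: IHn le1; rewrite E mulrDr !mulrBr !mulrDr !mulr1.
set t := tail _; set s := \sum_(_ <= _ < _) _; lra.
Qed.

Lemma tail_start_gt0 : 0 < tail (block_hi k0).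
Proof.
have Nk : (N <= block_hi k0)%N.
  have k0N : (N <= k0)%N by rewrite /k0; lia.
  have k01 : (0 < k0 ^ 2)%N by rewrite expn_gt0.
  by rewrite /block_hi expnS; nia.
rewrite lt0r pr_ge0 andbT; apply/eqP => t0.
by have := heavy true Nk; rewrite t0; lra.
Qed.

Lemma pr_good_ge_half n : tail (block_hi k0) / 2 <= pr P (good n).
Proof.
apply: le_trans (pr_good_ge n); rewrite ler_pM2l ?tail_start_gt0//.
have C00 : 0 <= C0 by rewrite addr_ge0// mulr_ge0// exprn_ge0.
have := sum_inv_cube_le R n (isT : (1 < k0)%N).
have : 2 * C0 <= k0.-1%:R.
  apply: le_trans (ltW (truncnS_gt _)) _; by rewrite ler_nat /k0 /= ltnS leq_addl.
set s := \sum_(_ <= _ < _) _; set K := k0.-1%:R => CK sK.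
have K0 : 0 < K by rewrite /K ltr0n.
have : C0 * s <= C0 / K by exact: ler_wpM2l.
have : C0 / K <= 2^-1 by rewrite ler_pdivrMr//; lra.
lra.
Qed.

(** On the intersection every demand of every block from [k0] on is met, which is
    what a ladder needs. *)
Lemma good_all_words_seen : \bigcap_n good n `<=` all_words_seen.
Proof.
move=> w H; apply/words_seen_setTP.
have k0N : (N <= k0)%N by rewrite /k0; lia.
apply: (@ladder_reads _ _ block_lo block_hi k0).
- by rewrite /block_lo expn_gt0.
- by have [S _] := H 0%N I; have := S 0%N isT.
- by move=> j; rewrite /block_hi /block_lo leq_pmull.
move=> j x y kj /andP[ly yh].
have nF : ~ failure j w.
  have [_ A] := H (j - k0).+1 I.
  by have := A (j - k0)%N; rewrite subnKC//; apply; rewrite mem_iota add0n ltnSn.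
have pick hi y' : (x, hi, y') \in demands j -> (y <= y')%N -> (hi <= y)%N ->
    (hi <= (block_hi j).+1)%N ->
    exists v, [/\ (block_lo j <= v <= block_hi j)%N, arrow (M ^~ w) v y & X v w = x].
  move=> D yy' hy hh; apply: contrapT => nv; apply: nF; exists (x, hi, y') => //.
  move=> v /= /andP[lv vh]; apply/implyP => /eqP Xv.
  rewrite ltnNge; apply/negP => yv.
  have yMv : (y <= v + M v w)%N := leq_trans yy' yv.
  have vy : (v < y)%N := leq_trans vh hy.
  have vb : (v <= block_hi j)%N by rewrite -ltnS (leq_trans vh hh).
  by apply: nv; exists v; split=> //; [rewrite lv|rewrite /arrow vy].
have xI : x \in [:: true; false] by case: (x).
have [yb|hy] := leqP y (block_hi j).
  apply: (pick (y - N)%N y) => //; try lia.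
  rewrite mem_cat; apply/orP; left.
  by apply/allpairsPdep; exists x, y; split=> //; rewrite mem_index_iota ly ltnS.
apply: (pick (block_hi j).+1 (block_hi j.+1)) => //.
by rewrite mem_cat; apply/orP; right; apply/mapP; exists x.
Qed.

(** The lower bound does not depend on [n], and passes to the limit of the
    decreasing events. *)
Lemma pr_all_words_seen_gt0 : (0 < P all_words_seen)%E.
Proof.
have mI : measurable (\bigcap_n good n).
  by apply: bigcap_measurableType => n _; exact: measurable_good.
apply: (@lt_le_trans _ _ (P (\bigcap_n good n))); last first.
  by apply: le_measure; rewrite ?inE//; [exact: measurable_all_words_seen
    |exact: good_all_words_seen].
have cvP : P (good n) @[n --> \oo] --> P (\bigcap_n good n).
  apply: nonincreasing_cvg_mu => //.
  - by rewrite (le_lt_trans (probability_le1 _ _)) ?ltry//; exact: measurable_good.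
  - by move=> n; exact: measurable_good.
  move=> m n mn; apply/subsetPset => w [S A]; split=> // j.
  by rewrite mem_iota => jm; apply: A; rewrite mem_iota; lia.
apply: (@lt_le_trans _ _ (tail (block_hi k0) / 2)%:E).
  by rewrite lte_fin divr_gt0// tail_start_gt0.
rewrite -(cvg_lim _ cvP)//; apply: lime_ge.
  by apply/cvg_ex; eexists; exact: cvP.
apply: nearW => n; rewrite prE ?lee_fin ?pr_good_ge_half//.
exact: measurable_good.
Qed.

End blocks.

End model.

(** * Thresholds on the upper and lower limits *)

Section limsup_thresholds.
Variable R : realType.
Implicit Types (v : (\bar R)^nat) (c : R).

Lemma limn_esup_lt_eventually v c : (limn_esup v < c%:E)%E ->
  exists n, forall j, (n <= j)%N -> (v j <= c%:E)%E.
Proof.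
rewrite /limn_esup limf_esupE => /ereal_inf_lt[_ [V [n _ nV] <-] supV].
exists n => j nj; apply: le_trans (ltW supV).
by apply: ereal_sup_ubound; exists j => //; exact: nV.
Qed.

Lemma lt_limn_einf_eventually v c : (c%:E < limn_einf v)%E ->
  exists n, forall j, (n <= j)%N -> (c%:E <= v j)%E.
Proof.
rewrite /limn_einf lteNr => /limn_esup_lt_eventually[n nP].
by exists n => j /nP; rewrite EFinN leeN2.
Qed.

End limsup_thresholds.

(** For the first part [a] is the rarer letter, of probability [q]; for the second
    part both letters have probability at least [q]. *)
Theorem theorem1p1 (R : realType) (p : R) (p_gt0 : 0 < p) (p_lt1 : p < 1)
    (d' : measure_display) (T' : measurableType d') (P' : probability T' R)
    (rho : {RV P' >-> nat})
    (d : measure_display) (T : measurableType d) (P : probability T R)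
    (M : nat -> {RV P >-> nat}) (X : nat -> {RV P >-> bool})
    (iidM : iid_with_law (distribution P' rho) M)
    (iidX : iid_with_law (bernoulli_prob p) X)
    (indepMX : independent_sequences M X) :
  ((limn_esup (fun n : nat => n%:R%:E * P' [set w | (n <= rho w)%N])
      < ((Num.min p (1 - p))^-1)%:E)%E ->
    P [set w | words_seen (M ^~ w) (X ^~ w) 0%N = [set: word]] = 0%E)
  /\
  (((3 / Num.min p (1 - p))%:E
      < limn_einf (fun n : nat => n%:R%:E * P' [set w | (n <= rho w)%N]))%E ->
    (0 < P [set w | words_seen (M ^~ w) (X ^~ w) 0%N = [set: word]])%E).
Proof.
set q := Num.min p (1 - p).
have q0 : 0 < q by rewrite lt_min p_gt0 subr_gt0.
pose tail j : R := pr (distribution P' rho) [set m | (j <= m)%N].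
have tailE j : (j%:R%:E * P' [set w | (j <= rho w)%N])%E = (j%:R * tail j)%:E.
  by rewrite EFinM -prE.
have p01 : 0 <= p <= 1 by rewrite !ltW.
have letter x : pr (bernoulli_prob p) [set x] = if x then p else 1 - p.
  transitivity (fine (p%:E * \d_true [set x] + (1 - p)%:E * \d_false [set x])%E).
    by congr fine; exact: bernoulli_probE.
  rewrite !diracE; case: x.
    by rewrite mem_set// memNset// mule1 mule0 adde0.
  by rewrite memNset// mem_set// mule1 mule0 add0e.
split=> [/limn_esup_lt_eventually|/lt_limn_einf_eventually] [n nP].
  pose a := p <= 1 - p.
  have la : pr (bernoulli_prob p) [set a] = q.
    by rewrite letter /a /q minEle; case: ifP.
  apply: (@pr_all_words_seen_eq0 _ _ _ _ _ _ _ _ iidM iidX indepMX a n);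
    rewrite la//.
    move=> j; apply: (@le_lt_trans _ _ q).
      by rewrite -[leRHS]mulr1 ler_wpM2l ?(ltW q0)// pr_le1.
    by rewrite gt_min p_lt1.
  move=> j nj; have := nP j nj; rewrite tailE lee_fin => H.
  by rewrite mulrCA -ler_pdivlMl ?mulr1.
apply: (pr_all_words_seen_gt0 iidM iidX indepMX (N := n.+1)) => // x j nj.
have := nP j (ltnW nj); rewrite tailE lee_fin ler_pdivrMr// => H.
apply: le_trans H _; rewrite -mulrA ler_wpM2l// mulrC ler_wpM2r ?pr_ge0//.
by rewrite letter /q; case: x; rewrite ge_min lexx ?orbT.
Qed.
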